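(* Let $G$ be a connected finite simple graph with vertex set $\{0,1,\dots,n\}$, let $\{k_1,k_2\}\in E(G)$, and let $C$ be a cell in the edge contraction subdivision $\mathcal{D}_{k_1,k_2}$ of $\nabla_G$. Then the undirected and directed cell subgraphs $G_C$ and $\vec{G}_C$ have the following properties. (i) $\vec{G}_C$ contains exactly one directed cycle, which is the 2-cycle $k_1\leftrightarrow k_2$ formed by $(k_1,k_2)$ and $(k_2,k_1)$. (ii) $V(G_C)=V(\vec{G}_C)=V(G)$. (iii) The edge set $E(\vec{G}_C)$ is closed under the map $\psi$ given by $\psi((i,j))=(\sigma(i),\sigma(j))$ if $\{\sigma(i),\sigma(j)\}\in E(G)$, and $\psi((i,j))=(i,j)$ otherwise, where $\sigma$ is the transposition of the vertices exchanging $k_1$ and $k_2$. (iv) $G_C$ is balanced with respect to the contraction of $G$ along $\{k_1,k_2\}$. (v) $G_C$ has a cycle basis (a basis, consisting of cycles, of its cycle space over $\mathbb{Z}_2$) with at most one odd cycle.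
   Context: For a connected finite simple graph $G$ with vertex set $V(G)=\{0,1,\dots,n\}$ and edge set $E(G)$, let $\mathbf{e}_1,\dots,\mathbf{e}_n$ be the standard basis of $\mathbb{R}^n$ and $\mathbf{e}_0=\mathbf{0}$. Put $A_G=\{\mathbf{e}_i-\mathbf{e}_j : \{i,j\}\in E(G)\}$ (both orientations of every edge are included). The adjacency polytope is $\nabla_G=\operatorname{conv}(A_G)\subset\mathbb{R}^n$. Edge contraction subdivision: for an edge $\{k_1,k_2\}\in E(G)$, let $\omega:A_G\to\mathbb{Z}$ be given by $\omega(\mathbf{e}_i-\mathbf{e}_j)=0$ if $\{i,j\}=\{k_1,k_2\}$ and $\omega(\mathbf{e}_i-\mathbf{e}_j)=1$ otherwise. $\mathcal{D}_{k_1,k_2}$ is the regular subdivision of $\nabla_G$ (as a subdivision of the point configuration $A_G$) induced by $\omega$: its cells are the subsets $C\subseteq A_G$ with $\dim\operatorname{conv}(C)=n$ for which there exist $\boldsymbol\alpha\in\mathbb{R}^n$ and $h\in\mathbb{R}$ with $\langle\mathbf{x},\boldsymbol\alpha\rangle+\omega(\mathbf{x})=h$ for all $\mathbf{x}\in C$ and $\langle\mathbf{x},\boldsymbol\alpha\rangle+\omega(\mathbf{x})>h$ for all $\mathbf{x}\in A_G\setminus C$. Cell subgraphs: for nonempty $X\subseteq A_G$, $\vec{G}_X$ is the directed graph with edge set $\{(i,j):\mathbf{e}_i-\mathbf{e}_j\in X\}$ and $G_X$ is the undirected simple graph with edge set $\{\{i,j\}:\mathbf{e}_i-\mathbf{e}_j\in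 X\text{ or }\mathbf{e}_j-\mathbf{e}_i\in X\}$; the vertices of both graphs are the endpoints of their edges. Balanced: a cycle $O$ in an undirected subgraph of $G$ is balanced with respect to the contraction along $\{k_1,k_2\}$ if $E(O)\setminus\{\{k_1,k_2\}\}$ contains an even number of edges. A subgraph of $G$ is balanced if all of its cycles are balanced. *)

(* Defs.v *)
From HB Require Import structures.
From mathcomp Require Import all_boot all_order all_fingroup all_algebra finmap.
From mathcomp Require Import classical_sets reals.

Set Implicit Arguments.
Unset Strict Implicit.
Unset Printing Implicit Defensive.

Import Order.TTheory GRing.Theory Num.Theory.
Local Open Scope ring_scope.

Section Convexity.
Variables (R : realType) (n : nat).
Implicit Types (A C : {fset 'rV[R]_n}) (S : set 'rV[R]_n) (x a : 'rV[R]_n).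

Definition dotp x a : R := \sum_i x 0 i * a 0 i.

Definition conv C : set 'rV[R]_n := [set x | exists w : 'rV[R]_n -> R,
  [/\ forall y, 0 <= w y, \sum_(y <- C) w y = 1
    & x = \sum_(y <- C) w y *: y]]%classic.

Definition aff_hull S : set 'rV[R]_n :=
  [set x | exists m (p : 'I_m -> 'rV[R]_n) (w : 'I_m -> R),
    [/\ forall i, S (p i), \sum_i w i = 1 & x = \sum_i w i *: p i]]%classic.

(* The affine hull of S is a translate of a d-dimensional linear subspace
   (so no d is the dimension of the empty set). *)
Definition has_dim S (d : nat) : Prop :=
  exists (x : 'rV[R]_n) (U : {vspace 'rV[R]_n}),
    \dim U = d /\ aff_hull S = [set y | y - x \in U]%classic.

(* C is a (full-dimensional) cell of the regular subdivision of the point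
   configuration A induced by the integer weights omega. *)
Definition regular_cell A (omega : 'rV[R]_n -> int) C : Prop :=
  [/\ (C `<=` A)%fset, has_dim (conv C) n
    & exists (alpha : 'rV[R]_n) (h : R),
        (forall x, x \in C -> dotp x alpha + (omega x)%:~R = h) /\
        (forall x, x \in A -> x \notin C -> h < dotp x alpha + (omega x)%:~R)].

End Convexity.

Section Contraction.
Variables (R : realType) (n : nat).
Implicit Types (i : 'I_n.+1) (e : rel 'I_n.+1) (C : {fset 'rV[R]_n}).

(* ev R ord0 = 0, and ev R (lift ord0 j) is the j-th standard basis vector. *)
Definition ev i : 'rV[R]_n := \row_(j < n) (i == lift ord0 j)%:R.

Definition adj_config e : {fset 'rV[R]_n} :=
  [fset ev ij.1 - ev ij.2 | ij in [pred ij : 'I_n.+1 * 'I_n.+1 | e ij.1 ij.2]]%fset.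

Definition contraction_weight (k1 k2 : 'I_n.+1) (x : 'rV[R]_n) : int :=
  if x \in [:: ev k1 - ev k2; ev k2 - ev k1] then 0 else 1.

Definition contraction_cell e (k1 k2 : 'I_n.+1) C : Prop :=
  regular_cell (adj_config e) (contraction_weight k1 k2) C.

Definition cell_arcs C : {set 'I_n.+1 * 'I_n.+1} :=
  [set ij | ev ij.1 - ev ij.2 \in C].

Definition cell_edges C : {set {set 'I_n.+1}} :=
  [set [set ij.1; ij.2] | ij in cell_arcs C].

End Contraction.

(* An undirected graph is given by its set of edges {x, y}, a digraph by its
   set of arcs (x, y); cycles are identified with their edge or arc sets, so
   that rotations of a vertex sequence give the same cycle. *)
Section Graphs.
Variable T : finType.
Implicit Types (E F : {set {set T}}) (D : {set T * T}).

Definition edge_vertices E : {set T} := finset.cover E.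

Definition arc_vertices D : {set T} :=
  [set x | [exists y, ((x, y) \in D) || ((y, x) \in D)]].

Definition is_dicycle D : Prop :=
  exists p : seq T,
    [/\ p != [::], uniq p & D = [set (x, next p x) | x in p]].

Definition is_cycle F : Prop :=
  exists p : seq T,
    [/\ (2 < size p)%N, uniq p & F = [set [set x; next p x] | x in p]].

Definition balanced (k1 k2 : T) E : Prop :=
  forall F, is_cycle F -> F \subset E -> ~~ odd #|F :\ [set k1; k2]|.

Definition even_subgraph E F : bool :=
  (F \subset E) && [forall v, ~~ odd #|[set f in F | v \in f]|].

Definition edge_vector F : {ffun {set T} -> ('F_2)^o} := [ffun f => (f \in F)%:R].

(* Even edge sets are closed under symmetric difference, so this span consists
   exactly of their indicator vectors. *)
Definition cycle_space E : {vspace {ffun {set T} -> ('F_2)^o}} :=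
  <<[seq edge_vector F | F <- enum (even_subgraph E)]>>%VS.

Definition cycle_basis E (B : seq {set {set T}}) : Prop :=
  (forall F, F \in B -> is_cycle F /\ F \subset E) /\
  basis_of (cycle_space E) [seq edge_vector F | F <- B].

Definition swap_arc (e : rel T) (k1 k2 : T) (ij : T * T) : T * T :=
  let s := tperm k1 k2 in
  if e (s ij.1) (s ij.2) then (s ij.1, s ij.2) else ij.

End Graphs.

(* Main.v *)
Require Import Defs.
From mathcomp Require Import all_boot all_order all_fingroup all_algebra finmap.
From mathcomp Require Import classical_sets reals.
From mathcomp Require Import boolp archimedean ring lra zify.
From mathcomp Require Import fintype finset.

(** A cell C comes with a linear functional alpha and a height h; writing
    a_i for the value of alpha at the i-th vertex (so that a vanishes at the
    vertex 0), every arc (i, j) of the cell satisfies a_i - a_j + w(i, j) = h,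
    where w is 0 on the contracted edge {k1, k2} and 1 elsewhere, and every
    other arc of G has a larger left-hand side.

    The key point is that h = 0. The two orientations of {k1, k2} give h <= 0.
    If h < 0, at most one of these orientations is in C. If there is none,
    alpha takes the value h - 1 on all of C; since C affinely spans the space,
    a linear functional that is constant on C is zero, so h = 1, a
    contradiction. If (k1, k2) is in C (the case of (k2, k1) is symmetric),
    the potential b_i = (a_i - a_k2) / (1 - h) grows by exactly 1 along every
    arc of C but (k1, k2), along which it climbs to 0 from a value strictly
    between -1 and 0. Rounding b down turns all these increments into 1, so
    again a linear functional takes a nonzero constant value on C
    ([height_ge0]).

    Hence a_k1 = a_k2, the arcs of C are both orientations of {k1, k2} and the
    other arcs (i, j) of G with a_j = a_i + 1 ([cell_potential]). The rest is
    read off this potential. It never decreases along an arc, so a directed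
    cycle has only arcs along which it is constant. A vertex avoided by C
    would have an indicator function without drop along the arcs of C, against
    full dimension. The potential is invariant under exchanging k1 and k2, so
    this exchange sends an arc of C to an arc of C whenever the image is an
    arc of G. The edges of the cell graph other than {k1, k2} are
    those that cross the cut given by the parity of the floor of the
    potential, and a cycle crosses a cut an even number of times
    ([even_cut]), so the cell graph is balanced.

    Finally, in a balanced graph the odd cycles are those through {k1, k2}.
    Fix one of them, if any; it spans the cycle space together with the even
    cycles: adding it to an even subgraph that contains {k1, k2} gives one
    that does not, and the latter is a disjoint union of cycles, all of them
    even ([even_span]). A basis extracted from this spanning family
    contains at most one odd cycle ([balanced_cycle_basis]). *)

Set Implicit Arguments.
Unset Strict Implicit.
Unset Printing Implicit Defensive.

Import Order.TTheory GRing.Theory Num.Theory.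
Local Open Scope ring_scope.

(** * Even subgraphs, cuts and cycles *)

Lemma odd_sum (I : Type) (r : seq I) (P : pred I) (g : I -> nat) :
  odd (\sum_(i <- r | P i) g i) = \big[addb/false]_(i <- r | P i) odd (g i).
Proof. exact: (big_morph odd oddD). Qed.

Lemma odd_card_sum (I : finType) (A : {set I}) (g : I -> nat) :
  odd #|[set i in A | odd (g i)]| = odd (\sum_(i in A) g i).
Proof.
rewrite -sum1_card !odd_sum.
rewrite (eq_bigl (fun i => (i \in A) && odd (g i))); last by move=> i; rewrite inE.
rewrite big_mkcondr; apply: eq_bigr => i _.
by case: (odd (g i)).
Qed.

Section EvenGraphs.
Variable T : finType.
Implicit Types (x y v : T) (f S : {set T}) (E F O : {set {set T}}).

Definition even_degrees F := forall v, ~~ odd #|[set f in F | v \in f]|.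

(** Both sides count, modulo 2, the incidences between the edges of F and the
    vertices of S: by edges this gives the size of the cut, by vertices the
    sum of the degrees. *)
Lemma even_cut F S :
  even_degrees F -> ~~ odd #|[set f in F | odd #|f :&: S|]|.
Proof.
move=> evF; rewrite odd_card_sum.
have -> : (\sum_(f in F) #|f :&: S| =
           \sum_(v in S) #|[set f in F | v \in f]|)%N.
  transitivity (\sum_(f in F) \sum_(v in S) (v \in f : nat))%N.
    apply: eq_bigr => f _; rewrite -sum1_card -big_mkcondr /=.
    by apply: eq_bigl => v; rewrite inE andbC.
  rewrite exchange_big /=; apply: eq_bigr => v _; rewrite -big_mkcondr sum1_card.
  by apply: eq_card => f; rewrite inE.
rewrite odd_sum big1 // => v _; exact/negbTE/evF.
Qed.

(** In a cyclic sequence of length at least 3, an edge {x, next x} determines x;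
    both this and x != next x are consequences of this fact. *)
Lemma next_next_neq (p : seq T) x :
  uniq p -> (2 < size p)%N -> x \in p -> next p (next p x) != x.
Proof.
move=> Up sp xp; have [i q Eq] := rot_to xp.
rewrite -!(next_rot i Up) Eq.
move: Up sp; rewrite -(rot_uniq i) -(size_rot i) Eq.
case: q {Eq} => [|a [|b q]] //= /and3P[]; rewrite !inE !negb_or.
case/and3P=> xa xb xq _ _ _; rewrite eqxx [a == x]eq_sym (negbTE xa) eqxx.
by rewrite eq_sym.
Qed.

Lemma cycle_even F : is_cycle F -> even_degrees F.
Proof.
case=> p [sp Up ->] v.
have next_neq x : x \in p -> x != next p x.
  move=> xp; apply/eqP=> Ex; have := next_next_neq Up sp xp.
  by rewrite -!Ex eqxx.
have inj : {in p &, injective (fun x => [set x; next p x])}.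
  move=> x y xp yp /= Exy; apply/eqP; apply: contraT => neq_xy.
  have: x \in [set y; next p y] by rewrite -Exy !inE eqxx.
  have: y \in [set x; next p x] by rewrite Exy !inE eqxx.
  rewrite !inE eq_sym (negbTE neq_xy) /= => /eqP Ey /eqP Ex.
  by have := next_next_neq Up sp xp; rewrite -Ey -Ex eqxx.
pose D := [set x in p].
have -> : [set [set x; next p x] | x in p] = [set [set x; next p x] | x in D] :> {set {set T}}.
  by apply/setP=> f; apply/imsetP/imsetP=> -[x xp ->]; exists x => //; move: xp; rewrite inE.
have oddE (G : {set {set T}}) : [set f in G | v \in f] = [set f in G | odd (v \in f)].
  by apply/setP=> f; rewrite !inE oddb.
rewrite oddE odd_card_sum big_imset /=; last first.
  by move=> x y; rewrite !inE; apply: inj.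
rewrite (eq_bigr (fun x => (v == x) + (v == next p x)))%N; last first.
  move=> x; rewrite !inE => xp; have := next_neq x xp.
  by case: (v =P x) => [->|_] //= /negbTE ->.
rewrite big_split /= [X in (X + _)%N](reindex_inj (can_inj (prev_next Up))) /=.
rewrite [X in (X + _)%N](eq_bigl (mem D)); last first.
  by move=> x; rewrite !inE mem_next.
by rewrite oddD addbb.
Qed.

(** Let f0 = {u, v}, and let S be the set of the vertices that can be reached
    from u in F without using f0. If v were not in S, the edge f0 would be the
    only edge of F crossing the cut S, contradicting [even_cut]; so there is a
    path from u to v that avoids f0, and f0 closes it into a cycle. *)
Lemma even_cycle_through F f0 :
    (forall f, f \in F -> #|f| = 2%N) -> even_degrees F -> f0 \in F ->
  exists O, [/\ is_cycle O, O \subset F & f0 \in O].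
Proof.
move=> F2 evF Ff0; have /eqP/cards2P[u [v [neq_uv Ef0]]] := F2 _ Ff0.
pose r := [rel x y : T | [set x; y] \in F :\ f0].
have r_conn : connect r u v.
  apply: contraT => nuv; pose S := [set x | connect r u x].
  have := even_cut S evF.
  suff -> : [set f in F | odd #|f :&: S|] = [set f0] by rewrite cards1.
  apply/setP=> f; rewrite !inE; apply/andP/eqP=> [[Ff]|->]; last first.
    split=> //; suff -> : f0 :&: S = [set u] by rewrite cards1.
    apply/setP=> x; rewrite Ef0 !inE.
    case: (x =P u) => [->|_] /=; first by rewrite connect0.
    by case: (x =P v) => [->|_] //=; apply/negbTE.
  apply: contraTeq => nff0; have /eqP/cards2P[x [y [neq_xy Ef]]] := F2 _ Ff.
  have rxy : r x y by rewrite /= -Ef !inE nff0.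
  have ryx : r y x by rewrite /= setUC -Ef !inE nff0.
  have Sxy : (x \in S) = (y \in S).
    by rewrite !inE; apply/idP/idP=> /connect_trans; apply; apply: connect1.
  have [Sx | nSx] := boolP (x \in S).
    suff -> : f :&: S = f by rewrite F2.
    by apply/setIidPl/subsetP=> z; rewrite Ef in_set2 => /orP[] /eqP-> //; rewrite -Sxy.
  suff -> : f :&: S = set0 by rewrite cards0.
  apply/setP=> z; rewrite in_setI Ef in_set2 in_set0.
  by apply/andP=> [[/orP[] /eqP->]]; rewrite -?Sxy (negbTE nSx).
have [q0 rq0 vq0] := connectP r_conn; case/shortenP: rq0 vq0 => q rq Uq _ Ev.
case/lastP: q rq Uq Ev => [|q w]; first by move=> _ _ /= Ev; rewrite Ev eqxx in neq_uv.
rewrite rcons_path last_rcons => /andP[rq rw] Uq Ev; rewrite -{w}Ev in rw Uq.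
have Up : uniq [:: v, u & q].
  by rewrite -(rotr1_rcons v (u :: q)) rotr_uniq.
(* Listing v first makes f0 = {v, u} the edge between the first two entries. *)
exists [set [set x; next [:: v, u & q] x] | x in [:: v, u & q]]; split.
- exists [:: v, u & q]; split=> //.
  case: q rq rw {Uq Up} => //= _.
  by rewrite !inE -Ef0 eqxx.
- apply/subsetP=> _ /imsetP[x xp ->].
  pose r' := [rel x y : T | [set x; y] \in F].
  apply: (@next_cycle _ r') xp => /=; rewrite setUC -Ef0 Ff0 /=.
  rewrite -[path _ _ _]/(path r' u (rcons q v)) rcons_path.
  have sub_r : subrel r r' by move=> a b /setD1P[].
  by rewrite (sub_path sub_r rq) (sub_r _ _ rw).
apply/imsetP; exists v; first by rewrite inE eqxx.
by rewrite /= eqxx setUC.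
Qed.

Definition symdiff E F := (E :\: F) :|: (F :\: E).

Lemma odd_card_symdiff (I : finType) (A B : {set I}) :
  odd #|(A :\: B) :|: (B :\: A)| = odd #|A| (+) odd #|B|.
Proof.
have disj : (A :\: B) :&: (B :\: A) = set0.
  by apply/setP=> x; rewrite !inE; case: (x \in A) (x \in B) => [] [].
rewrite cardsU disj cards0 subn0 -[in RHS](cardsID B A) -[in RHS](cardsID A B).
by rewrite setIC !oddD addbACA addbb.
Qed.

Lemma even_symdiff E F :
  even_degrees E -> even_degrees F -> even_degrees (symdiff E F).
Proof.
move=> evE evF v.
have -> : [set f in symdiff E F | v \in f] =
    ([set f in E | v \in f] :\: [set f in F | v \in f])
    :|: ([set f in F | v \in f] :\: [set f in E | v \in f]).
  by apply/setP=> f; rewrite !inE; case: (v \in f) (f \in E) (f \in F) => [] [] [].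
by rewrite odd_card_symdiff (negbTE (evE v)) (negbTE (evF v)).
Qed.

Lemma edge_vector_symdiff E F :
  edge_vector (symdiff E F) = edge_vector E + edge_vector F.
Proof.
apply/ffunP=> f; rewrite !ffunE !inE.
by case: (f \in E) (f \in F) => [] []; apply/eqP.
Qed.

(** An even edge set is a disjoint union of cycles: remove a cycle and
    repeat. *)
Lemma even_span F (W : {vspace {ffun {set T} -> ('F_2)^o}}) :
    (forall f, f \in F -> #|f| = 2%N) -> even_degrees F ->
    (forall O, is_cycle O -> O \subset F -> edge_vector O \in W) ->
  edge_vector F \in W.
Proof.
elim: {F}_.+1 {-2}F (ltnSn #|F|) => // m IH F ltF F2 evF cycW.
have [F0 | [f0 Ff0]] := set_0Vmem F.
  by rewrite F0 (_ : edge_vector _ = 0) ?mem0v //; apply/ffunP=> f; rewrite !ffunE inE.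
have [O [cycO sOF Of0]] := even_cycle_through F2 evF Ff0.
have EFO : F :\: O = symdiff F O.
  apply/setP=> f; rewrite !inE; move/subsetP/(_ f): sOF.
  by case: (f \in F) (f \in O) => [] [] // /(_ isT).
have Esum : edge_vector F = edge_vector (F :\: O) + edge_vector O.
  rewrite -edge_vector_symdiff; congr edge_vector; apply/setP=> f.
  by rewrite !inE; move/subsetP/(_ f): sOF; case: (f \in F) (f \in O) => [] [] // /(_ isT).
rewrite Esum memvD //; last exact: cycW.
apply: IH.
- rewrite (leq_trans _ (ltF : (#|F| <= m)%N)) //; apply: proper_card.
  apply/properP; split; first exact: subsetDl.
  by exists f0; rewrite // inE Of0.
- by move=> f /setDP[/F2].
- by rewrite EFO; apply: even_symdiff => //; apply: cycle_even.
by move=> O' cycO' sO'; apply: cycW => //; apply: subset_trans sO' (subsetDl _ _).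
Qed.

End EvenGraphs.

Lemma exists_sub_basis (K : fieldType) (vT : vectType K) (I : eqType)
    (g : I -> vT) (L : seq I) :
  exists B, subseq B L /\ basis_of <<map g L>> (map g B).
Proof.
elim: L => [|x L [B [sBL /andP[/eqP spB frB]]]].
  by exists [::]; split=> //; rewrite /basis_of nil_free eqxx.
have [gx | gx] := boolP (g x \in <<map g L>>%VS).
  exists B; split; first exact: subseq_trans sBL (subseq_cons _ _).
  by rewrite /basis_of frB spB /= span_cons eqEsubv addvSr subv_add -memvE gx subvv.
exists (x :: B); split; first by rewrite /= eqxx.
by rewrite /basis_of /= free_cons spB gx frB !span_cons spB eqxx.
Qed.

Lemma mem_cycle_space (T : finType) (E F : {set {set T}}) :
  F \subset E -> even_degrees F -> edge_vector F \in cycle_space E.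
Proof.
move=> sFE evF; apply: memv_span; apply: map_f; rewrite mem_enum.
by rewrite unfold_in sFE; apply/forallP.
Qed.

(** In a balanced graph a cycle is odd exactly when it uses {k1, k2}, and the
    sum of an even subgraph through {k1, k2} with one fixed odd cycle avoids
    {k1, k2}; so one odd cycle and the even cycles span the cycle space. *)
Lemma balanced_cycle_basis (T : finType) (k1 k2 : T) (E : {set {set T}}) :
    (forall f, f \in E -> #|f| = 2%N) -> balanced k1 k2 E ->
  exists B : seq {set {set T}},
    cycle_basis E B /\ (count (fun F : {set {set T}} => odd #|F|) B <= 1)%N.
Proof.
move=> E2 balE; pose k := [set k1; k2].
pose L := [seq F <- enum {set {set T}} | `[< is_cycle F /\ F \subset E >]].
have LP F : reflect (is_cycle F /\ F \subset E) (F \in L).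
  by rewrite mem_filter mem_enum andbT; apply: asboolP.
have oddP F : F \in L -> odd #|F| = (k \in F).
  by case/LP=> cF sF; rewrite (cardsD1 k) oddD (negbTE (balE F cF sF)) addbF oddb.
pose odds := [seq F : {set {set T}} <- L | odd #|F|].
pose evens := [seq F : {set {set T}} <- L | ~~ odd #|F|].
(* [take 1] keeps one odd cycle, or none if all cycles are even. *)
pose M := take 1 odds ++ evens.
have sML : {subset M <= L}.
  move=> F; rewrite mem_cat => /orP[/mem_take|]; by rewrite mem_filter => /andP[].
have [B [sBM basB]] := exists_sub_basis (@edge_vector T) M.
exists B; split; last first.
  rewrite (leq_trans (leq_count_subseq _ sBM)) // count_cat.
  rewrite [X in (_ + X)%N](_ : _ = 0)%N; last first.
    by apply/eqP; rewrite -leqn0 leqNgt -has_count; apply/hasPn=> F; rewrite mem_filter => /andP[].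
  by rewrite addn0 (leq_trans (count_size _ _)) // size_take; case: ltnP.
split; first by move=> F /(mem_subseq sBM)/sML/LP.
suff -> : cycle_space E = <<map (@edge_vector T) M>>%VS by [].
have no_k (F : {set {set T}}) : F \subset E -> even_degrees F -> k \notin F ->
    edge_vector F \in <<map (@edge_vector T) M>>%VS.
  move=> sF evF nkF; apply: even_span => // [f /(subsetP sF)/E2 //|O cO sO].
  apply/memv_span/map_f; rewrite mem_cat mem_filter orbC.
  have LO : O \in L by apply/LP; split=> //; apply: subset_trans sF.
  by rewrite LO oddP // (contra _ nkF) //; apply: (subsetP sO).
apply/eqP; rewrite eqEsubv; apply/andP; split; apply/span_subvP => _ /mapP[F + ->].
  rewrite mem_enum unfold_in => /andP[sF /forallP evF].
  have [kF|] := boolP (k \in F); last exact: no_k.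
  have F2 f : f \in F -> #|f| = 2%N by move/(subsetP sF)/E2.
  have [O0 [cO0 sO0 kO0]] := even_cycle_through F2 evF kF.
  have LO0 : O0 \in L by apply/LP; split=> //; apply: subset_trans sF.
  have : O0 \in odds by rewrite mem_filter LO0 oddP // kO0.
  rewrite /M; case Eo: odds => [//|O o] _.
  have : O \in odds by rewrite Eo mem_head.
  rewrite mem_filter => /andP[oO LO]; have [cO sO] := LP _ LO.
  have -> : edge_vector F = edge_vector (symdiff F O) + edge_vector O.
    rewrite -edge_vector_symdiff; congr edge_vector.
    by apply/setP=> f; rewrite !inE; case: (f \in F) (f \in O) => [] [].
  rewrite memvD //; last by apply/memv_span/map_f; rewrite mem_head.
  have := no_k (symdiff F O); rewrite /M Eo; apply.
  - apply/subsetP=> f; rewrite !inE => /orP[] /andP[_].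
      exact: (subsetP sF).
    exact: (subsetP sO).
  - by apply: even_symdiff => //; apply: cycle_even.
  by rewrite !inE kF -oddP // oO.
by move/sML/LP=> [cF sF]; apply: mem_cycle_space => //; apply: cycle_even.
Qed.

(** * Functionals that are constant on a full-dimensional configuration *)

Section FullDimension.
Variables (R : realType) (n : nat).
Implicit Types (x y a : 'rV[R]_n) (C : {fset 'rV[R]_n}).

Lemma dotp_sum (I : Type) (r : seq I) (w : I -> R) (p : I -> 'rV[R]_n) a :
  dotp (\sum_(i <- r) w i *: p i) a = \sum_(i <- r) w i * dotp (p i) a.
Proof.
rewrite /dotp (eq_bigr (fun j => \sum_(i <- r) w i * (p i 0 j * a 0 j))).
  by rewrite exchange_big; apply: eq_bigr => i _; rewrite mulr_sumr.
move=> j _; rewrite summxE mulr_suml; apply: eq_bigr => i _.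
by rewrite mxE mulrA.
Qed.

(** Being constant on C passes to its convex hull and then to its affine hull,
    which is the whole space; evaluating at 0 and at the standard basis vectors
    gives the conclusion. *)
Lemma full_dim_dotp C a (t : R) :
    has_dim (conv C) n -> (forall x, x \in C -> dotp x a = t) ->
  a = 0 /\ t = 0.
Proof.
case=> x0 [U [dimU affC]] Ca.
have convCa x : conv C x -> dotp x a = t.
  case=> w [_ sw ->]; rewrite dotp_sum.
  under eq_big_seq => y yC do rewrite Ca //.
  by rewrite -mulr_suml sw mul1r.
have all_a y : dotp y a = t.
  have : aff_hull (conv C) y.
    rewrite affC /=; suff -> : U = fullv by rewrite memvf.
    by apply/eqP; rewrite eqEdim subvf dimU dimvf /dim /= mul1n.
  case=> m [p [w [Cp sw ->]]]; rewrite dotp_sum.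
  under eq_bigr => i _ do rewrite convCa //.
  by rewrite -mulr_suml sw mul1r.
have t0 : t = 0.
  by rewrite -(all_a 0) /dotp big1 // => i _; rewrite mxE mul0r.
split=> //; apply/rowP=> j; rewrite mxE.
have := all_a (delta_mx 0 j); rewrite t0 /dotp (bigD1 j) //= big1 ?addr0.
  by rewrite mxE !eqxx mul1r.
by move=> i /negbTE ne; rewrite mxE ne andbF mul0r.
Qed.

End FullDimension.

Section Arcs.
Variables (R : realType) (n : nat).
Implicit Types (i j : 'I_n.+1) (e : rel 'I_n.+1) (C : {fset 'rV[R]_n}).

Lemma dotp_ev i (a : 'rV[R]_n) :
  dotp (ev R i) a = if unlift ord0 i is Some j then a 0 j else 0.
Proof.
rewrite /dotp; case: unliftP => [j ->|->].
  rewrite (bigD1 j) //= big1 ?addr0; first by rewrite mxE eqxx mul1r.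
  by move=> k /negbTE ne; rewrite mxE (inj_eq lift_inj) eq_sym ne mul0r.
by rewrite big1 // => k _; rewrite mxE (negbTE (neq_lift _ _)) mul0r.
Qed.

Lemma dotpB (x y a : 'rV[R]_n) : dotp (x - y) a = dotp x a - dotp y a.
Proof. by rewrite /dotp -sumrB; apply: eq_bigr => i _; rewrite !mxE mulrBl. Qed.

(** Linear functionals on the space are the same as vertex potentials up to
    additive constants; the normalisation at the vertex 0 reflects that this
    vertex is placed at the origin. *)
Lemma dotp_arc (c : 'I_n.+1 -> R) i j :
  dotp (ev R i - ev R j) (\row_l (c (lift ord0 l) - c ord0)) = c i - c j.
Proof.
have dev l : dotp (ev R l) (\row_l (c (lift ord0 l) - c ord0)) = c l - c ord0.
  by rewrite dotp_ev; case: unliftP => [m ->|->]; rewrite ?mxE ?subrr.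
by rewrite dotpB !dev; ring.
Qed.

(** The points of two arcs are separated by the potentials that are the
    indicator functions of the endpoints. *)
Lemma arc_inj i j i' j' :
  i != j -> ev R i - ev R j = ev R i' - ev R j' -> i = i' /\ j = j'.
Proof.
move=> ij Eij.
have tst l : (l == i)%:R - (l == j)%:R = (l == i')%:R - (l == j')%:R :> R.
  pose c m : R := (l == m)%:R.
  by rewrite -[LHS](dotp_arc c) Eij dotp_arc.
clear Eij; split; apply/eqP; apply: contraT => /negbTE ne.
  have := tst i; rewrite eqxx ne (negbTE ij).
  by case: (i == j') => /= ?; lra.
have := tst j; rewrite eqxx ne eq_sym (negbTE ij).
by case: (j == i') => /= ?; lra.
Qed.

Section Cell.
Variables (e : rel 'I_n.+1) (e_irr : irreflexive e).
Variables (C : {fset 'rV[R]_n}).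

Lemma mem_adj_config i j : (ev R i - ev R j \in adj_config R e) = e i j.
Proof.
apply/imfsetP/idP => /= [[[i' j'] /= eij /esym/arc_inj[]]|eij].
- by apply: contraTneq (eij : e i' j') => ->; rewrite e_irr.
- by move=> <- <-.
by exists (i, j).
Qed.

Lemma full_dim_potential (c : 'I_n.+1 -> R) (t : R) :
    (C `<=` adj_config R e)%fset -> has_dim (conv C) n ->
    (forall i j, (i, j) \in cell_arcs C -> c i - c j = t) ->
  (forall i j, c i = c j) /\ t = 0.
Proof.
move=> /fsubsetP sCA dimC Cc.
have [|c0 t0] := full_dim_dotp (a := \row_l (c (lift ord0 l) - c ord0)) (t := t) dimC.
  move=> x xC; have /imfsetP[[i j] /= eij Ex] := sCA _ xC.
  by rewrite Ex dotp_arc; apply: Cc; rewrite inE /= -Ex.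
split=> // i j; apply/eqP; rewrite -subr_eq0 -dotp_arc c0.
by apply/eqP; rewrite /dotp big1 // => l _; rewrite [X in _ * X]mxE mulr0.
Qed.

End Cell.
End Arcs.

(** * The potential of a cell *)

Lemma eq_set2 (T : finType) (i j k l : T) :
  ([set i; j] == [set k; l]) = ((i, j) == (k, l)) || ((i, j) == (l, k)).
Proof.
apply/eqP/orP=> [Es|[] /eqP[-> ->] //]; last exact: setUC.
have: (i \in [set k; l]) && (j \in [set k; l]) by rewrite -Es !inE !eqxx orbT.
have: (k \in [set i; j]) && (l \in [set i; j]) by rewrite Es !inE !eqxx orbT.
rewrite !inE !xpair_eqE.
rewrite ![k == _]eq_sym ![l == _]eq_sym.
by case: (i == k) (i == l) (j == k) (j == l) => [] [] [] [] //; auto.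
Qed.

Section CellPotential.
Variables (R : realType) (n : nat) (e : rel 'I_n.+1).
Hypotheses (e_sym : symmetric e) (e_irr : irreflexive e).
Variable C : {fset 'rV[R]_n}.

Lemma contraction_weight_arc (k1 k2 i j : 'I_n.+1) : k1 != k2 ->
  contraction_weight k1 k2 (ev R i - ev R j) = ([set i; j] != [set k1; k2])%:R.
Proof.
move=> k12; have -> : ([set i; j] != [set k1; k2])%:R =
    if [set i; j] == [set k1; k2] then 0 else 1 :> int.
  by case: eqP.
rewrite /contraction_weight !inE eq_set2; congr (if _ then _ else _).
congr orb; apply/eqP/eqP; try by case=> -> ->.
  by move/esym/arc_inj => /(_ k12)[-> ->].
by move/esym/arc_inj; rewrite eq_sym => /(_ k12)[-> ->].
Qed.

(** If h < 0, the normalised potential b below grows by exactly 1 along each arc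
    of C except (k1, k2), while b k1 lies strictly between -1 and 0 = b k2.
    Its floor c then grows by exactly 1 along every arc of C, including
    (k1, k2), which full dimension forbids. *)
Lemma height_ge0 (k1 k2 : 'I_n.+1) (a : 'I_n.+1 -> R) (h : R) :
    (C `<=` adj_config R e)%fset -> has_dim (conv C) n ->
    (k1, k2) \in cell_arcs C ->
    (forall i j, (i, j) \in cell_arcs C ->
      a i - a j + ([set i; j] != [set k1; k2])%:R = h) ->
  0 <= h.
Proof.
move=> sCA dimC k12 Ca; rewrite leNgt; apply/negP=> h0.
have h1 : 1 - h != 0 by apply/eqP; lra.
have Ek : a k1 - a k2 = h by rewrite -(Ca _ _ k12) eqxx addr0.
pose b i := (a i - a k2) / (1 - h).
pose c i : R := (Num.floor (b i))%:~R.
suff Cc : forall i j, (i, j) \in cell_arcs C -> c i - c j = -1.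
  by have [_ /eqP] := full_dim_potential sCA dimC Cc; rewrite oppr_eq0 oner_eq0.
move=> i j Cij; have := Ca i j Cij; case: (eqVneq [set i; j] [set k1; k2]) => [|_] /= Eij.
  move/eqP: Eij; rewrite eq_set2 => /orP[] /eqP[-> ->] Eij; last by clear sCA dimC; lra.
  have -> : c k2 = 0 by rewrite /c /b subrr mul0r floor0.
  suff fl : Num.floor (b k1) = -1 by rewrite /c fl subr0.
  apply/floor_def; rewrite /b Ek addNr mulr0z.
  by rewrite ler_pdivlMr ?ltr_pdivrMr; lra.
have -> : c j = c i + 1.
  rewrite /c (_ : b j = b i + 1); first by rewrite floorDrz // floor1 rmorphD.
  by rewrite /b -[X in _ = _ + X](divff h1) -mulrDl; congr (_ / _); lra.
lra.
Qed.

(** The cell is the set of arcs where a vertex potential takes the largest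
    steps allowed, 1 in general and 0 on the contracted edge; this is the form
    in which every property of the cell graphs is proved. *)
Lemma cell_potential (k1 k2 : 'I_n.+1) :
    e k1 k2 -> contraction_cell e k1 k2 C ->
  exists2 a : 'I_n.+1 -> R, a k1 = a k2 &
    forall i j, ((i, j) \in cell_arcs C) =
      e i j && (a j == a i + ([set i; j] != [set k1; k2])%:R).
Proof.
move=> k12 [sCA dimC [alpha [h [Ceq Cgt]]]].
have nk12 : k1 != k2 by apply: contraTneq k12 => ->; rewrite e_irr.
pose w i j : R := ([set i; j] != [set k1; k2])%:R.
pose a i := dotp (ev R i) alpha.
have Edot i j : dotp (ev R i - ev R j) alpha
    + (contraction_weight k1 k2 (ev R i - ev R j))%:~R = a i - a j + w i j.
  by rewrite dotpB contraction_weight_arc // /w; case: (_ == _).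
have Ca i j : (i, j) \in cell_arcs C -> a i - a j + w i j = h.
  by rewrite inE /= => /Ceq; rewrite Edot.
have nCa i j : e i j -> (i, j) \notin cell_arcs C -> h < a i - a j + w i j.
  by rewrite -Edot inE /= => eij nC; apply: Cgt; rewrite ?mem_adj_config.
have Ce i j : (i, j) \in cell_arcs C -> e i j.
  by rewrite inE /= => /(fsubsetP sCA); rewrite mem_adj_config.
have le_h i j : e i j -> h <= a i - a j + w i j.
  by move=> eij; have [/Ca ->|/(nCa _ _ eij)/ltW] := boolP ((i, j) \in cell_arcs C).
have wk : w k1 k2 = 0 by rewrite /w eqxx.
have wk' : w k2 k1 = 0 by rewrite /w setUC eqxx.
have := le_h _ _ k12; have := le_h k2 k1; rewrite e_sym wk wk' => /(_ k12) hk1 hk2.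
have h_ge0 : 0 <= h.
  have [C12|nC12] := boolP ((k1, k2) \in cell_arcs C); first exact: height_ge0 C12 Ca.
  have [C21|nC21] := boolP ((k2, k1) \in cell_arcs C).
    by apply: height_ge0 C21 _ => // i j Cij; rewrite [[set k2; _]]setUC; apply: Ca.
  (* All points of C now have weight 1, so the functional is constant on C. *)
  have [|_ t0] := @full_dim_potential _ _ e C a (h - 1) sCA dimC; last lra.
  move=> i j Cij; have := Ca i j Cij; rewrite /w eq_set2.
  case: eqP => [Eij|_]; first by rewrite -Eij Cij in nC12.
  case: eqP => [Eij|_]; first by rewrite -Eij Cij in nC21.
  by move=> /=; lra.
exists a; first by lra.
have h0 : h = 0 by lra.
move=> i j; apply/idP/andP=> [Cij|[eij /eqP Eij]].
  by split; [exact: Ce | apply/eqP; have := Ca _ _ Cij; rewrite -/(w i j); lra].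
by apply: contraT => /(nCa _ _ eij); rewrite -/(w i j) in Eij; lra.
Qed.

End CellPotential.

(** * The cell graphs *)

Section CellGraphs.
Variables (R : realType) (n : nat) (e : rel 'I_n.+1) (k1 k2 : 'I_n.+1).
Hypotheses (e_sym : symmetric e) (e_irr : irreflexive e) (k12 : e k1 k2).
Variables (C : {fset 'rV[R]_n}) (a : 'I_n.+1 -> R).
Hypotheses (a_k : a k1 = a k2)
  (arcE : forall i j, ((i, j) \in cell_arcs C) =
      e i j && (a j == a i + ([set i; j] != [set k1; k2])%:R)).

Lemma arc_k12 : (k1, k2) \in cell_arcs C.
Proof. by rewrite arcE k12 eqxx addr0 a_k eqxx. Qed.

Lemma arc_k21 : (k2, k1) \in cell_arcs C.
Proof. by rewrite arcE e_sym k12 [[set k2; _]]setUC eqxx addr0 a_k eqxx. Qed.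

(** The steps of the potential add up to 0 around a directed cycle and are
    nonnegative, so all of them vanish and all arcs are orientations of
    {k1, k2}. *)
Lemma dicycle_in_cell (F : {set 'I_n.+1 * 'I_n.+1}) :
  is_dicycle F /\ F \subset cell_arcs C <-> F = [set (k1, k2); (k2, k1)].
Proof.
have nk12 : k1 != k2 by apply: contraTneq k12 => ->; rewrite e_irr.
split=> [[[p [p0 Up ->]] /subsetP sFC]|->]; last first.
  split; last by apply/subsetP=> ij; rewrite !inE => /orP[] /eqP->;
    have := arc_k12; have := arc_k21; rewrite !inE.
  exists [:: k1; k2]; split=> //; first by rewrite /= inE nk12.
  have E1 : next [:: k1; k2] k1 = k2 by rewrite /= eqxx.
  have E2 : next [:: k1; k2] k2 = k1 by rewrite /= eq_sym (negbTE nk12) eqxx.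
  apply/setP=> ij; rewrite !inE; apply/orP/imsetP => [[] /eqP->|[x]].
  - by exists k1; rewrite ?E1 ?inE ?eqxx.
  - by exists k2; rewrite ?E2 ?inE ?eqxx ?orbT.
  by rewrite !inE => /orP[] /eqP-> ->; rewrite ?E1 ?E2; [left|right].
have arc x : x \in p -> (x, next p x) \in cell_arcs C.
  by move=> xp; apply: sFC; apply/imsetP; exists x.
pose s x : R := ([set x; next p x] != [set k1; k2])%:R.
have s_sum : \sum_(x in p) s x = 0.
  have: \sum_(x in p) a (next p x) = \sum_(x in p) a x.
    rewrite [RHS](reindex_inj (can_inj (prev_next Up))) /=.
    by apply: eq_bigl => x; rewrite mem_next.
  have -> : \sum_(x in p) a (next p x) = \sum_(x in p) (a x + s x).
    by apply: eq_bigr => x /arc; rewrite arcE => /andP[_ /eqP].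
  by rewrite big_split /= => /eqP; rewrite -subr_eq0 addrAC subrr add0r => /eqP.
have s0 x : x \in p -> ((x, next p x) == (k1, k2)) || ((x, next p x) == (k2, k1)).
  move=> xp; rewrite -eq_set2; apply: contraT => nx.
  move/eqP: s_sum; rewrite psumr_eq0 => [/allP/(_ x)|y _]; last exact: ler0n.
  by rewrite mem_index_enum xp /s nx oner_eq0 => /(_ isT).
have k1p : k1 \in p.
  have [x xq] : exists x, x \in p by case: (p) p0 => // x q _; exists x; apply: mem_head.
  case/orP: (s0 _ xq) => /eqP[Ex En]; first by rewrite -Ex.
  by rewrite -En mem_next.
have N1 : next p k1 = k2.
  by have := s0 _ k1p; rewrite !xpair_eqE (negbTE nk12) eqxx /= orbF => /eqP.
have k2p : k2 \in p by rewrite -N1 mem_next.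
have N2 : next p k2 = k1.
  by have := s0 _ k2p; rewrite !xpair_eqE [k2 == k1]eq_sym (negbTE nk12) eqxx /= => /eqP.
apply/eqP; rewrite eqEsubset; apply/andP; split; apply/subsetP=> ij.
  by case/imsetP=> x /s0 xs ->; rewrite !inE.
by rewrite !inE => /orP[] /eqP->; apply/imsetP; [exists k1|exists k2]; rewrite ?N1 ?N2.
Qed.

(** The indicator function of a vertex that meets no arc would be a nonconstant
    potential without drop on the cell. *)
Lemma arc_vertices_cell :
    (C `<=` adj_config R e)%fset -> has_dim (conv C) n ->
  arc_vertices (cell_arcs C) = [set: 'I_n.+1].
Proof.
move=> sCA dimC; apply/setP=> v; rewrite in_setT inE.
apply: contraT => /existsPn nv.
pose c x : R := (x == v)%:R.
have nk12 : k1 != k2 by apply: contraTneq k12 => ->; rewrite e_irr.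
have [|c_const _] := @full_dim_potential _ _ e C c 0 sCA dimC.
  move=> i j Cij; rewrite /c.
  have := nv i; rewrite negb_or; case: (j =P v) => [<-|_]; first by rewrite Cij andbF.
  by have := nv j; rewrite negb_or; case: (i =P v) => [<-|_]; rewrite ?Cij ?subrr.
have cst i : i = v.
  apply/eqP; have := c_const i v; rewrite /c eqxx.
  by case: eqP => // _ /eqP; rewrite eq_sym oner_eq0.
by rewrite (cst k1) (cst k2) eqxx in nk12.
Qed.

Lemma edge_vertices_cell : edge_vertices (cell_edges C) = arc_vertices (cell_arcs C).
Proof.
apply/setP=> v; rewrite [RHS]inE; apply/bigcupP/existsP=> [[_ /imsetP[[i j] Cij ->]]|[y]].
  by rewrite !inE => /orP[] /eqP->; [exists j|exists i]; rewrite Cij ?orbT.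
by case/orP=> Cvy; eexists; try (apply: imset_f; exact: Cvy); rewrite !inE eqxx ?orbT.
Qed.

Lemma swap_arc_cell ij : ij \in cell_arcs C -> swap_arc e k1 k2 ij \in cell_arcs C.
Proof.
case: ij => i j Cij; rewrite /swap_arc /=; case: ifP => // es.
have a_s x : a (tperm k1 k2 x) = a x by case: tpermP => [->|->|].
move: Cij; rewrite !arcE es !a_s => /andP[_ /eqP->] /=; apply/eqP.
congr (_ + (~~ _)%:R).
have -> : [set tperm k1 k2 i; tperm k1 k2 j] = [set tperm k1 k2 x | x in [set i; j]].
  by rewrite imsetU !imset_set1.
have Ek : [set k1; k2] = [set tperm k1 k2 x | x in [set k1; k2]].
  by rewrite imsetU !imset_set1 tpermL tpermR setUC.
by rewrite [in RHS]Ek (inj_eq (imset_inj perm_inj)).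
Qed.

Lemma cell_edge_card f : f \in cell_edges C -> #|f| = 2%N.
Proof.
case/imsetP=> [[i j]] /= + ->; rewrite arcE cards2 => /andP[eij _].
by rewrite (_ : i != j) //; apply: contraTneq eij => ->; rewrite e_irr.
Qed.

(** The potential of a vertex need not be an integer, but its floor grows by 1
    along each arc where the potential does; so the edges other than {k1, k2}
    are those crossing the cut S between even and odd floors. *)
Lemma balanced_cell : balanced k1 k2 (cell_edges C).
Proof.
move=> F cF sF.
pose S := [set i | (2 %| Num.floor (a i))%Z].
have := even_cut S (cycle_even cF).
suff -> : [set f in F | odd #|f :&: S|] = F :\ [set k1; k2] by [].
apply/setP=> f; rewrite !inE andbC; have [Ff|] := boolP (f \in F); last by rewrite !andbF.
rewrite !andbT; have f2 := cell_edge_card (subsetP sF _ Ff).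
have /imsetP[[i j] /= Cij Ef] := subsetP sF _ Ff.
have neq_ij : i != j by move: f2; rewrite Ef cards2; case: (_ != _).
have -> : odd #|f :&: S| = (i \in S) (+) (j \in S).
  have -> : f :&: S = [set x in f | odd (x \in S)].
    by apply/setP=> x; rewrite !inE oddb.
  by rewrite odd_card_sum Ef big_setU1 ?in_set1 //= big_set1 oddD !oddb.
have inS x : (x \in S) = (2 %| Num.floor (a x))%Z by rewrite inE.
move: Cij; rewrite arcE -Ef !inS => /andP[_ /eqP->].
case: (f == _); first by rewrite addr0 addbb.
rewrite floorDrz // floor1; set z : int := Num.floor (a i).
by clearbody z; clear -z; lia.
Qed.

End CellGraphs.

Theorem theorem3 (R : realType) (n : nat) (e : rel 'I_n.+1)
    (e_sym : symmetric e) (e_irr : irreflexive e)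
    (e_conn : forall x y, connect e x y)
    (k1 k2 : 'I_n.+1) (k12 : e k1 k2)
    (C : {fset 'rV[R]_n}) (cellC : contraction_cell e k1 k2 C) :
  [/\ forall F : {set 'I_n.+1 * 'I_n.+1},
        is_dicycle F /\ F \subset cell_arcs C <->
        F = [set (k1, k2); (k2, k1)],
      edge_vertices (cell_edges C) = [set: 'I_n.+1] /\
        arc_vertices (cell_arcs C) = [set: 'I_n.+1],
      forall ij, ij \in cell_arcs C -> swap_arc e k1 k2 ij \in cell_arcs C,
      balanced k1 k2 (cell_edges C)
    & exists B : seq {set {set 'I_n.+1}},
        cycle_basis (cell_edges C) B /\
        (count (fun F : {set {set 'I_n.+1}} => odd #|F|) B <= 1)%N].
Proof.
have [sCA dimC _] := cellC.
have [a a_k arcE] := cell_potential e_sym e_irr k12 cellC.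
have vC := arc_vertices_cell e_irr k12 sCA dimC.
have balC := balanced_cell e_irr arcE.
split=> //.
- by move=> F; apply: (dicycle_in_cell e_sym e_irr k12 a_k arcE).
- by rewrite edge_vertices_cell.
- exact: swap_arc_cell a_k arcE.
- apply: balanced_cycle_basis balC => f; exact: (cell_edge_card e_irr arcE).
Qed.
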